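(* Let $N\ge2$ and let $\{\mathbb{R};h_1,\dots,h_N\}$ be a homogeneous iterated function system of similarity transformations $h_i(x)=cx+d_i$ ($i=1,\dots,N$), where $c\in(-1,1)\setminus\{0\}$ and $d_i\in\mathbb{R}$. Then $\Delta_n=\Delta_n^*$ for all $n\in\mathbb{N}$.
   Context: For $i=i_1i_2\dots i_n\in\{1,\dots,N\}^n$ put $h_i=h_{i_1}\circ\cdots\circ h_{i_n}$; this map has the form $h_i(x)=c^nx+d_i$ for some $d_i\in\mathbb{R}$. The attractor $A$ is the unique nonempty compact set with $A=\bigcup_{i=1}^N h_i(A)$, and $\mathrm{co}(A)$ is its closed convex hull. For similarities $\Phi(x)=sx+d$ and $\Phi_*(x)=s_*x+d_*$ of $\mathbb{R}$, the distance is $d(\Phi,\Phi_* )=|\log s-\log s_*|+|d-d_*|$, where the first term is taken to be $0$ when $s=s_*$ (the only case needed here). Define $$\Delta_n=\inf\{d(h_i,h_j): i,j\in\{1,\dots,N\}^n,\ i\ne j\},$$ $$\Delta_n^*=\inf\{\mathfrak{H}(h_i(\mathrm{co}(A)),h_j(\mathrm{co}(A))): i,j\in\{1,\dots,N\}^n,\ i\neq j\},$$ where $\mathfrak{H}$ is the Hausdorff distance between nonempty compact subsets of $\mathbb{R}$. *)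

(* Defs.v *)
From HB Require Import structures.
From mathcomp Require Import all_boot all_order all_algebra.
From mathcomp Require Import all_classical all_reals all_analysis.

Set Implicit Arguments.
Unset Strict Implicit.
Unset Printing Implicit Defensive.

Import Order.TTheory GRing.Theory Num.Theory.
Import numFieldNormedType.Exports.

Local Open Scope classical_set_scope.
Local Open Scope ring_scope.

Record similarity (R : realType) := Similarity {
  ratio : R;
  transl : R;
  ratio_neq0 : ratio != 0
}.

Definition sim_fun (R : realType) (f : similarity R) : R -> R :=
  fun x => ratio f * x + transl f.

Coercion sim_fun : similarity >-> Funclass.

Definition sim_id (R : realType) : similarity R := Similarity 0 (oner_neq0 R).

Definition sim_comp (R : realType) (f g : similarity R) : similarity R :=
  Similarity (ratio f * transl g + transl f)
             (mulf_neq0 (ratio_neq0 f) (ratio_neq0 g)).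

Lemma sim_idE (R : realType) : sim_id R =1 id.
Proof. by move=> x; rewrite /sim_fun /= mul1r addr0. Qed.

Lemma sim_compE (R : realType) (f g : similarity R) : sim_comp f g =1 f \o g.
Proof. by move=> x; rewrite /sim_fun /= mulrDr mulrA addrA. Qed.

(* h_i = h_(i_1) o ... o h_(i_n) for the word i = i_1 ... i_n *)
Definition sim_word (R : realType) (N : nat) (h : 'I_N -> similarity R)
    (n : nat) (i : n.-tuple 'I_N) : similarity R :=
  foldr (fun k f => sim_comp (h k) f) (sim_id R) i.

Definition is_attractor (R : realType) (N : nat) (h : 'I_N -> similarity R)
    (A : set R) : Prop :=
  [/\ A !=set0, compact A & A = \bigcup_(i in [set: 'I_N]) (h i @` A)].

Definition closed_convex_hull (R : realType) (A : set R) : set R :=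
  smallest [set B : set R | closed B /\ convex_set (B : set (convex_lmodType R^o))] A.

(* [ln] is the logarithm only at positive arguments (it is 0 elsewhere), so for
   distinct ratios this is the intended distance only when both are positive;
   equal ratios, of either sign, contribute 0. *)
Definition sim_dist (R : realType) (f g : similarity R) : R :=
  (if ratio f == ratio g then 0 else `|ln (ratio f) - ln (ratio g)|)
  + `|transl f - transl g|.

Definition dist_to_set (R : realType) (x : R) (B : set R) : R :=
  inf [set `|x - b| | b in B].

(* Intended for nonempty bounded sets: [sup] and [inf] are 0 by default. *)
Definition hausdorff_dist (R : realType) (A B : set R) : R :=
  Num.max (sup [set dist_to_set a B | a in A])
          (sup [set dist_to_set b A | b in B]).

(* The infima defining [Delta] and [Delta_star] are taken in the extended reals,
   so that at n = 0, where there is no pair of distinct words, both are +oo. *)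
Definition Delta (R : realType) (N : nat) (h : 'I_N -> similarity R) (n : nat) :
    \bar R :=
  ereal_inf [set r | exists i j : n.-tuple 'I_N,
    i <> j /\ r = (sim_dist (sim_word h i) (sim_word h j))%:E].

Definition Delta_star (R : realType) (N : nat) (h : 'I_N -> similarity R)
    (A : set R) (n : nat) : \bar R :=
  ereal_inf [set r | exists i j : n.-tuple 'I_N,
    i <> j /\ r = (hausdorff_dist (sim_word h i @` closed_convex_hull A)
                                  (sim_word h j @` closed_convex_hull A))%:E].

(* Main.v *)
(** For equal ratios the distance of two similarities is the distance of their
    translation parts, and their images of a set are translates of each other.
    The Hausdorff distance between a nonempty bounded set [B] and [t + B],
    [0 <= t], is exactly [t]: every point has a partner at distance [t], while a
    point of [B] within [e] of [inf B] is at distance at least [t - e] from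
    [t + B]. *)
Require Import Defs.
From HB Require Import structures.
From mathcomp Require Import all_boot all_order all_algebra.
From mathcomp Require Import all_classical all_reals all_analysis.
From mathcomp Require Import lra.
(* [fraction] also exports a [ratio]; this restores the one of [Defs]. *)
Import Defs.

Import Order.TTheory GRing.Theory Num.Theory.
Import numFieldNormedType.Exports.

Local Open Scope classical_set_scope.
Local Open Scope ring_scope.

Lemma dist_to_set_le (R : realType) (x b : R) (B : set R) :
  B b -> dist_to_set x B <= `|x - b|.
Proof.
by move=> Bb; apply: ge_inf; [exists 0 => _ [y _ <-] | exists b].
Qed.

Lemma ubound_dist_to_set (R : realType) (B C : set R) (r : R) :
  (forall b, B b -> exists2 c, C c & `|b - c| <= r) ->
  ubound [set dist_to_set b C | b in B] r.
Proof.
move=> BC _ [b Bb <-]; have [c Cc] := BC _ Bb.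
by apply: le_trans; apply: dist_to_set_le.
Qed.

Lemma hausdorff_distC (R : realType) (B C : set R) :
  hausdorff_dist B C = hausdorff_dist C B.
Proof. by rewrite /hausdorff_dist maxC. Qed.

Lemma hausdorff_dist_translate (R : realType) (B : set R) (t : R) :
  has_inf B -> 0 <= t -> hausdorff_dist B [set t + b | b in B] = t.
Proof.
move=> infB t0; have [[b0 Bb0] lbB] := infB.
set C := [set t + b | b in B]; have C0 : C (t + b0) by exists b0.
have ub1 : ubound [set dist_to_set b C | b in B] t.
  apply: ubound_dist_to_set => b Bb; exists (t + b); first by exists b.
  by rewrite opprD addrCA subrr addr0 normrN ger0_norm.
have ub2 : ubound [set dist_to_set b B | b in C] t.
  apply: ubound_dist_to_set => _ [b Bb <-]; exists b => //.
  by rewrite addrK ger0_norm.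
apply/eqP; rewrite eq_le ge_max le_max; apply/andP; split.
  apply/andP; split; apply: ge_sup => //; first by eexists; exists b0.
  by eexists; exists (t + b0).
(* For the lower bound one of the two suprema is enough. The one over [B] is taken, with a point
   [b < inf B + e] as its witness. *)
apply/orP; left; apply/ler_addgt0Pl => e e0.
have [b Bb bB] := inf_adherent e0 infB.
rewrite -lerBlDl; apply: (@le_trans _ _ (dist_to_set b C)); last first.
  by apply: ub_le_sup; [exists t | exists b].
apply: lb_le_inf; first by eexists; exists (t + b0).
(* Since [inf B <= y], the difference [t + y - b] already exceeds [t - e]. *)
move=> _ [_ [y By <-] <-]; have := ge_inf lbB By => By'.
by rewrite distrC; apply: le_trans (ler_norm _); lra.
Qed.

Lemma has_inf_affine_image (R : realType) (K : set R) (f : similarity R) :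
  K !=set0 -> bounded_set K -> has_inf (f @` K).
Proof.
move=> [k0 Kk0] [M [_ KM]]; split; first by exists (f k0), k0.
(* [bounded_set] only gives bounds strictly above [M], and [M] may be negative; [|M| + 1] is a
   nonnegative one. *)
have {}KM k : K k -> `|k| <= `|M| + 1.
  by apply: KM; rewrite (le_lt_trans (ler_norm M)) ?ltrDl.
exists (transl f - `|ratio f| * (`|M| + 1)) => _ [k Kk <-].
rewrite /sim_fun addrC lerD2r lerNl -mulNr.
apply: le_trans (ler_norm _) _.
by rewrite normrM normrN ler_wpM2l // KM.
Qed.

Lemma sim_image_translate (R : realType) (K : set R) (f g : similarity R) :
  ratio f = ratio g ->
  g @` K = [set transl g - transl f + y | y in f @` K].
Proof.
move=> fg; rewrite image_comp; apply: eq_imagel => x _ /=.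
by rewrite /sim_fun fg; lra.
Qed.

Lemma hausdorff_dist_sim_image (R : realType) (K : set R) (f g : similarity R) :
  K !=set0 -> bounded_set K -> ratio f = ratio g ->
  hausdorff_dist (f @` K) (g @` K) = `|transl f - transl g|.
Proof.
(* Both sides are symmetric in [f] and [g], so the shift may be taken nonnegative. *)
move=> K0 Kb; wlog fg : f g / transl f <= transl g => [wl rfg|rfg].
  have [fg|/ltW gf] := leP (transl f) (transl g); first exact: wl.
  by rewrite hausdorff_distC distrC; exact: wl.
rewrite (sim_image_translate _ K f g rfg) hausdorff_dist_translate ?subr_ge0//.
  by rewrite distrC ger0_norm ?subr_ge0.
exact: has_inf_affine_image.
Qed.

Lemma sim_dist_eq_ratio (R : realType) (f g : similarity R) :
  ratio f = ratio g -> sim_dist f g = `|transl f - transl g|.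
Proof. by move=> fg; rewrite /sim_dist fg eqxx add0r. Qed.

Lemma convex_set_itvcc (R : realType) (a b : R) :
  convex_set (`[a, b]%classic : set (convex_lmodType R^o)).
Proof.
move=> x y l; rewrite !inE /= !in_itv /= => /andP[ax xb] /andP[ay yb].
have -> : conv l x y = l%:num * (x : R) + (1 - l%:num) * (y : R) :> R by [].
have l0 : 0 <= l%:num by [].
have l1 : l%:num <= 1 by [].
by apply/andP; split; nra.
Qed.

(** A symmetric interval [[-M', M']] containing [A] is closed and convex, so it is one of the sets
    intersected to form the hull. *)
Lemma bounded_closed_convex_hull (R : realType) (A : set R) :
  bounded_set A -> bounded_set (closed_convex_hull A).
Proof.
move=> [M [Mreal AM]]; exists M; split => // M' MM' x hullx.
have AM' : A `<=` `[- M', M']%classic.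
  by move=> y /(AM _ MM'); rewrite /= in_itv /= ler_norml.
have := hullx `[- M', M']%classic; rewrite /= in_itv /= ler_norml; apply.
by split=> //; split; [exact: itv_closed | exact: convex_set_itvcc].
Qed.

Lemma closed_convex_hull_neq0 (R : realType) (A : set R) :
  A !=set0 -> closed_convex_hull A !=set0.
Proof. by move=> [a Aa]; exists a => B [_]; apply. Qed.

Lemma ratio_sim_word (R : realType) (N : nat) (h : 'I_N -> similarity R) (c : R)
    (n : nat) (i : n.-tuple 'I_N) :
  (forall k, ratio (h k) = c) -> ratio (sim_word h i) = c ^+ n.
Proof.
(* Only the exponent becomes [size i], so that induction can run on the underlying list. *)
move=> hc; rewrite /sim_word -{2}(size_tuple i).
by elim: (tval i) => //= k s ->; rewrite hc exprS.
Qed.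

Theorem proposition3p7 (R : realType) (N : nat) (hN : (2 <= N)%N)
    (c : R) (hc : -1 < c < 1) (hc0 : c != 0) (d : 'I_N -> R)
    (h : 'I_N -> similarity R) (hh : forall (i : 'I_N) (x : R), h i x = c * x + d i)
    (A : set R) (hA : is_attractor h A) (n : nat) :
  Delta h n = Delta_star h A n.
Proof.
have [A0 Ac _] := hA.
have ratioh k : ratio (h k) = c.
  (* The values at 0 and 1 determine an affine map. *)
  by have := hh k 0; have := hh k 1; rewrite /sim_fun; lra.
have distE (i j : n.-tuple 'I_N) :
    hausdorff_dist (sim_word h i @` closed_convex_hull A)
                   (sim_word h j @` closed_convex_hull A) =
    sim_dist (sim_word h i) (sim_word h j).
  have rE : ratio (sim_word h i) = ratio (sim_word h j).
    by rewrite !(ratio_sim_word _ _ _ c).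
  rewrite sim_dist_eq_ratio // hausdorff_dist_sim_image //.
    exact: closed_convex_hull_neq0.
  exact/bounded_closed_convex_hull/compact_bounded.
(* The distances agree pair by pair, so both infima range over the same set, which is empty when
   [n = 0]. *)
rewrite /Delta /Delta_star; congr ereal_inf; apply/seteqP.
by split=> r [i [j [ij ->]]]; exists i, j; rewrite distE.
Qed.
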